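(* Let $F$ be a number field Galois over $\mathbb Q$, $M$ an even integer divisible by the discriminant of $F$, $n\ge1$, $i\mapsto\sigma_i\in\mathrm{Gal}(F/\mathbb Q)$ ($i=1,\dots,n$, $\sigma_1=\mathrm{id}$) a vertical gauge, $p$ a prime not dividing $M$, $\mathfrak P$ a prime of $\mathcal O_F$ dividing $p$, and $q\in GL_n(\mathcal O_F[1/M])$ with $q^t=q$. Assume $q$ is vertical gauge invariant, i.e. $\sigma_i(q)=q$ for $i=1,\dots,n$. Let $(\varphi_{ij})$ be the curvature of the vertical Levi-Civita connection attached to $q$ at $\mathfrak P$, $\Phi_{ij}:=\varphi_{ij}(x)$, and let $R_{ijmk}$ be the $(m,k)$ entry of the matrix $x^{(p^2)t}q^{(p^2)}\Phi_{ij}$. Then for all $i,j,k,m$ the following congruences hold in $\mathcal O(\widehat{G^1})$: $$R_{ijkm}\equiv-R_{ijmk}\ \text{mod }p,\qquad R_{ijkm}\equiv-R_{jikm}\ \text{mod }p,$$ $$R_{mijk}+R_{mjki}+R_{mkij}\equiv0\ \text{mod }p,\qquad R_{ijkm}\equiv R_{kmij}\ \text{mod }p.$$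
   Context: For a matrix $a=(a_{ij})$, $a^t$ is the transpose, $a^{(p)}=(a_{ij}^p)$ and $a^{(p^2)}=(a_{ij}^{p^2})$; set maps between rings are applied to matrices entrywise. A Frobenius lift on a ring $A$ is a ring endomorphism reducing mod $p$ to the $p$-power Frobenius of $A/pA$. On a $p$-torsion free ring a $p$-derivation $\delta$ is the same as a Frobenius lift $\phi$, via $\phi(a)=a^p+p\,\delta a$ (''attached''). $\widehat{\ }$ denotes $p$-adic completion. Set $\mathfrak P_i=\sigma_i\mathfrak P$ and let $R_i=\widehat{\mathcal O_{\mathfrak P_i}}$ be the $p$-adic completion of the localization of $\mathcal O_F$ at $\mathfrak P_i$ (a complete discrete valuation ring with maximal ideal generated by the odd prime $p$). It has a unique Frobenius lift $\phi^i$, hence a unique $p$-derivation $\delta^i$. Let $x$ be an $n\times n$ matrix of indeterminates, $G^i=\mathrm{Spec}\,R_i[x,\det(x)^{-1}]$, $\mathcal O(\widehat{G^i})=R_i[x,\det(x)^{-1}]^{\widehat{\ }}$. The automorphism $\sigma_i$ induces an isomorphism $R_1\to R_i$, extended to $\sigma_i:\mathcal O(\widehat{G^1})\to\mathcal O(\widehat{G^i})$ by $\sigma_i(x)=x$. A vertical connection at $\mathfrak P$ is an $n$-tuple $(\delta^1,\dots,\delta^n)$ where $\delta^i$ is a $p$-derivation on $\mathcal O(\widehat{G^i})$ extending that of $R_i$ (same notation), with attached Frobenius lift $\phi^i$. It is metric with respect to $q$ if for every $i$, $\phi^i\circ\mathcal H_q=\mathcal H_q\circ\phi^i_0$, where $\mathcal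 H_q$ is the (continuous) $R_i$-algebra endomorphism of $\mathcal O(\widehat{G^i})$ with $x\mapsto x^tqx$ and $\phi_0^i$ is the Frobenius lift extending that of $R_i$ with $\phi_0^i(x)=x^{(p)}$. With $\gamma_i=(\gamma_{ijk})_{j,k}:=(\delta^ix)^t\cdot\phi^i(q)\cdot x^{(p)}$, it is torsion free relative to $q$ if $\sigma_i^{-1}\gamma_{ijk}=\sigma_j^{-1}\gamma_{jik}$ for all $i,j,k$. The vertical Levi-Civita connection attached to $q$ at $\mathfrak P$ is the unique (it exists) vertical connection that is metric with respect to $q$ and torsion free relative to $q$. Its curvature is the family of additive maps $\varphi_{ij}:\mathcal O(\widehat{G^1})\to\mathcal O(\widehat{G^1})$, $$\varphi_{ij}=\frac1p\{\sigma_i^{-1}\phi^i\sigma_i\sigma_j^{-1}\phi^j\sigma_j-\sigma_j^{-1}\phi^j\sigma_j\sigma_i^{-1}\phi^i\sigma_i\}$$ (composition of maps, rightmost first). *)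

(* Defs.v *)
From HB Require Import structures.
From mathcomp Require Import all_boot all_order all_fingroup all_algebra all_field.
From mathcomp Require Import ring.
From mathcomp Require Import boolp mpoly.

Set Implicit Arguments.
Unset Strict Implicit.
Unset Printing Implicit Defensive.

Import GRing.Theory.

Local Open Scope ring_scope.
Local Open Scope quotient_scope.

(* The quotient A / p^k A. mathcomp's {ideal_quot _} only covers proper       *)
(* ideals, whereas k = 0 (or p a unit) has to be allowed here, so only its    *)
(* Z-module part {quot _} is reused.                                          *)
Section ModPow.
Variables (p : nat) (A : comPzRingType) (k : nat).

Definition pmult : {pred A} := [pred a | `[< exists b : A, a = b *+ p ^ k >]].

Lemma pmultP a : reflect (exists b : A, a = b *+ p ^ k) (a \in pmult).
Proof. by rewrite inE; apply: asboolP. Qed.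

Fact pmult_zmod_closed : zmod_closed pmult.
Proof.
split=> [|a b /pmultP[c ->] /pmultP[d ->]]; apply/pmultP.
  by exists 0; rewrite mul0rn.
by exists (c - d); rewrite mulrnBl.
Qed.
HB.instance Definition _ := GRing.isZmodClosed.Build A pmult pmult_zmod_closed.

Definition modpow : Type := Quotient.quot pmult.
HB.instance Definition _ := GRing.Zmodule.on modpow.

Definition pi_modpow (a : A) : modpow := \pi_(Quotient.quot pmult) a.

Lemma pi_modpowP a b :
  pi_modpow a = pi_modpow b <-> exists c, a = b + c *+ p ^ k.
Proof.
have E : (pi_modpow a == pi_modpow b) = (a - b \in pmult).
  by rewrite /pi_modpow -Quotient.idealrBE.
split=> [ab|[c cE]].
  have /pmultP[c cE] : a - b \in pmult by rewrite -E ab eqxx.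
  by exists c; rewrite -cE addrC subrK.
by apply/eqP; rewrite E cE; apply/pmultP; exists c; rewrite addrAC subrr add0r.
Qed.

Lemma modpow_surj (z : modpow) : exists a, z = pi_modpow a.
Proof. by exists (generic_quotient.repr (z : Quotient.quot pmult)); rewrite /pi_modpow reprK. Qed.

Fact pi_modpow_is_zmod : zmod_morphism pi_modpow.
Proof. by move=> a b; rewrite /pi_modpow piE. Qed.
HB.instance Definition _ :=
  GRing.isZmodMorphism.Build A modpow pi_modpow pi_modpow_is_zmod.

Definition modpow_one : modpow := pi_modpow 1.
Definition modpow_mul (y z : modpow) : modpow :=
  pi_modpow (generic_quotient.repr (y : Quotient.quot pmult) * generic_quotient.repr (z : Quotient.quot pmult)).

Fact modpow_mulE a b :
  modpow_mul (pi_modpow a) (pi_modpow b) = pi_modpow (a * b).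
Proof.
have rE c : exists d, generic_quotient.repr (pi_modpow c : Quotient.quot pmult) = c + d *+ p ^ k.
  by apply/pi_modpowP; rewrite /pi_modpow reprK.
rewrite /modpow_mul; have [[c ->] [d ->]] := (rE a, rE b).
apply/pi_modpowP; exists (a * d + c * b + (c * d) *+ p ^ k).
rewrite mulrDl !mulrDr -!addrA; congr (_ + _).
by rewrite !mulrnDl !(mulrnAr, mulrnAl) addrA.
Qed.

Fact modpow_mulA : associative modpow_mul.
Proof.
move=> x y z.
have [[a ->] [b ->] [c ->]] := And3 (modpow_surj x) (modpow_surj y) (modpow_surj z).
by rewrite !modpow_mulE mulrA.
Qed.
Fact modpow_mulC : commutative modpow_mul.
Proof.
move=> x y; have [[a ->] [b ->]] := conj (modpow_surj x) (modpow_surj y).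
by rewrite !modpow_mulE mulrC.
Qed.
Fact modpow_mul1 : left_id modpow_one modpow_mul.
Proof. by move=> x; have [a ->] := modpow_surj x; rewrite modpow_mulE mul1r. Qed.
Fact modpow_mulDl : left_distributive modpow_mul +%R.
Proof.
move=> x y z.
have [[a ->] [b ->] [c ->]] := And3 (modpow_surj x) (modpow_surj y) (modpow_surj z).
by rewrite -raddfD !modpow_mulE -raddfD mulrDl.
Qed.
HB.instance Definition _ := GRing.Zmodule_isComPzRing.Build modpow
  modpow_mulA modpow_mulC modpow_mul1 modpow_mulDl.

Fact pi_modpow_is_monoid : monoid_morphism pi_modpow.
Proof. by split=> // a b; rewrite -modpow_mulE. Qed.
HB.instance Definition _ :=
  GRing.isMonoidMorphism.Build A modpow pi_modpow pi_modpow_is_monoid.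

End ModPow.

(* The p-adic completion, as the inverse limit of the rings A / p^k A. A      *)
(* family of classes is compatible with the projections A/p^(k+1) -> A/p^k    *)
(* iff its entries of index k and k+1 have a common representative.           *)
Section Completion.
Variables (p : nat) (A : comPzRingType).

Definition coherent (c : forall k, modpow p A k) :=
  forall k, exists a, c k = pi_modpow p k a /\ c k.+1 = pi_modpow p k.+1 a.

Record padic := Padic {
  padic_coord : forall k, modpow p A k;
  padic_coordP : coherent padic_coord
}.
HB.instance Definition _ := gen_eqMixin padic.
HB.instance Definition _ := gen_choiceMixin padic.

Lemma padic_eq (x y : padic) : (forall k, padic_coord x k = padic_coord y k) -> x = y.
Proof.
case: x y => [c cP] [d dP] /= cd.
have {cd} e : c = d by apply: functional_extensionality_dep.
by case: _ / e dP => dP; congr Padic; apply: Prop_irrelevance.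
Qed.

Fact coherent_const a : coherent (fun k => pi_modpow p k a).
Proof. by move=> k; exists a. Qed.
Fact coherent_opp x : coherent (fun k => - padic_coord x k).
Proof. by move=> k; have [a [-> ->]] := padic_coordP x k; exists (- a); rewrite !rmorphN. Qed.
Fact coherent_add x y : coherent (fun k => padic_coord x k + padic_coord y k).
Proof.
move=> k; have [a [-> ->]] := padic_coordP x k; have [b [-> ->]] := padic_coordP y k.
by exists (a + b); rewrite !rmorphD.
Qed.
Fact coherent_mul x y : coherent (fun k => padic_coord x k * padic_coord y k).
Proof.
move=> k; have [a [-> ->]] := padic_coordP x k; have [b [-> ->]] := padic_coordP y k.
by exists (a * b); rewrite !rmorphM.
Qed.

Definition to_padic a := Padic (coherent_const a).
Definition padic_opp x := Padic (coherent_opp x).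
Definition padic_add x y := Padic (coherent_add x y).
Definition padic_mul x y := Padic (coherent_mul x y).

Fact padic_addA : associative padic_add.
Proof. by move=> x y z; apply: padic_eq => k; apply: addrA. Qed.
Fact padic_addC : commutative padic_add.
Proof. by move=> x y; apply: padic_eq => k; apply: addrC. Qed.
Fact padic_add0 : left_id (to_padic 0) padic_add.
Proof. by move=> x; apply: padic_eq => k; rewrite /= raddf0 add0r. Qed.
Fact padic_addN : left_inverse (to_padic 0) padic_opp padic_add.
Proof. by move=> x; apply: padic_eq => k; rewrite /= raddf0 addNr. Qed.
HB.instance Definition _ :=
  GRing.isZmodule.Build padic padic_addA padic_addC padic_add0 padic_addN.

Fact padic_mulA : associative padic_mul.
Proof. by move=> x y z; apply: padic_eq => k; apply: mulrA. Qed.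
Fact padic_mulC : commutative padic_mul.
Proof. by move=> x y; apply: padic_eq => k; apply: mulrC. Qed.
Fact padic_mul1 : left_id (to_padic 1) padic_mul.
Proof. by move=> x; apply: padic_eq => k; rewrite /= rmorph1 mul1r. Qed.
Fact padic_mulDl : left_distributive padic_mul +%R.
Proof. by move=> x y z; apply: padic_eq => k; apply: mulrDl. Qed.
HB.instance Definition _ := GRing.Zmodule_isComPzRing.Build padic
  padic_mulA padic_mulC padic_mul1 padic_mulDl.

Fact to_padic_is_zmod : zmod_morphism to_padic.
Proof. by move=> a b; apply: padic_eq => k; rewrite /= raddfB. Qed.
Fact to_padic_is_monoid : monoid_morphism to_padic.
Proof. by split=> // a b; apply: padic_eq => k; rewrite /= rmorphM. Qed.
HB.instance Definition _ :=
  GRing.isZmodMorphism.Build A padic to_padic to_padic_is_zmod.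
HB.instance Definition _ :=
  GRing.isMonoidMorphism.Build A padic to_padic to_padic_is_monoid.

Lemma padic_neq0 : (forall b : A, 1 <> b *+ p) -> (1 : padic) != 0.
Proof.
move=> nu; apply/eqP => /(congr1 (fun x => padic_coord x 1)) /=.
by case/pi_modpowP => c; rewrite add0r expn1; apply: nu.
Qed.

End Completion.

Section CompletionMap.
Variables (p : nat) (A B : comPzRingType) (f : {rmorphism A -> B}).

Definition modpow_map k (z : modpow p A k) : modpow p B k :=
  pi_modpow p k
    (f (generic_quotient.repr (z : Quotient.quot (pmult p (A:=A) k)))).

Lemma modpow_mapE k a : modpow_map (pi_modpow p k a) = pi_modpow p k (f a).
Proof.
rewrite /modpow_map; set r := generic_quotient.repr _.
have /pi_modpowP[c ->] : pi_modpow p k r = pi_modpow p k a.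
  by rewrite /pi_modpow reprK.
by apply/pi_modpowP; exists (f c); rewrite rmorphD rmorphMn.
Qed.

Fact coherent_map (x : padic p A) : coherent (fun k => modpow_map (padic_coord x k)).
Proof.
by move=> k; have [a [-> ->]] := padic_coordP x k; exists (f a); rewrite !modpow_mapE.
Qed.
Definition padic_map (x : padic p A) : padic p B := Padic (coherent_map x).

Fact padic_map_is_zmod : zmod_morphism padic_map.
Proof.
move=> x y; apply: padic_eq => k /=.
have [a [-> _]] := padic_coordP x k; have [b [-> _]] := padic_coordP y k.
by rewrite -raddfB !modpow_mapE !raddfB.
Qed.
Fact padic_map_is_monoid : monoid_morphism padic_map.
Proof.
split=> [|x y]; apply: padic_eq => k /=; first by rewrite modpow_mapE rmorph1.
have [a [-> _]] := padic_coordP x k; have [b [-> _]] := padic_coordP y k.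
by rewrite -rmorphM !modpow_mapE !rmorphM.
Qed.
HB.instance Definition _ :=
  GRing.isZmodMorphism.Build (padic p A) (padic p B) padic_map padic_map_is_zmod.
HB.instance Definition _ :=
  GRing.isMonoidMorphism.Build (padic p A) (padic p B) padic_map padic_map_is_monoid.

Lemma padic_map_to a : padic_map (to_padic p a) = to_padic p (f a).
Proof. by apply: padic_eq => k; apply: modpow_mapE. Qed.

End CompletionMap.

Lemma padic_mapK p (A B : comPzRingType)
  (f : {rmorphism A -> B}) (g : {rmorphism B -> A}) :
  cancel f g -> cancel (padic_map (p:=p) f) (padic_map g).
Proof.
move=> fK x; apply: padic_eq => k /=.
by have [a [-> _]] := padic_coordP x k; rewrite !modpow_mapE fK.
Qed.

(* The localization A[1/s]: the class of (a, k) stands for a / s^k.           *)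
Section Away.
Variables (A : comNzRingType) (s : A).

Definition away_rel : rel (A * nat) := fun u v =>
  `[< exists m, s ^+ m * (u.1 * s ^+ v.2) = s ^+ m * (v.1 * s ^+ u.2) >].

Fact away_rel_equiv : equiv_class_of away_rel.
Proof.
split=> [u|u v|v u w]; first by apply/asboolP; exists 0.
  by apply/asboolP/asboolP => -[m E]; exists m.
move=> /asboolP[m E] /asboolP[l G]; apply/asboolP; exists (m + l + v.2)%N.
transitivity (s ^+ l * s ^+ w.2 * (s ^+ m * (u.1 * s ^+ v.2))).
  by rewrite !exprD; ring.
rewrite E; transitivity (s ^+ m * s ^+ u.2 * (s ^+ l * (v.1 * s ^+ w.2))).
  by ring.
by rewrite G !exprD; ring.
Qed.
Canonical away_equiv := EquivRelPack away_rel_equiv.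
Canonical away_encModRel := defaultEncModRel away_rel.

Definition away := {eq_quot away_rel}.
HB.instance Definition _ := Choice.on away.
HB.instance Definition _ := EqQuotient.on away.

Definition away_frac (a : A) (k : nat) : away := \pi_away (a, k).

Lemma away_fracP a k b l : away_frac a k = away_frac b l <->
  exists m, s ^+ m * (a * s ^+ l) = s ^+ m * (b * s ^+ k).
Proof.
have E : (away_frac a k == away_frac b l) = away_rel (a, k) (b, l).
  by rewrite /away_frac piE.
by split=> [/eqP|h]; [rewrite E => /asboolP | apply/eqP; rewrite E; apply/asboolP].
Qed.

Lemma away_surj (z : away) : exists a k, z = away_frac a k.
Proof.
exists (generic_quotient.repr z).1, (generic_quotient.repr z).2.
by rewrite /away_frac -surjective_pairing reprK.
Qed.

Definition away_opp (z : away) : away :=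
  let u := generic_quotient.repr z in away_frac (- u.1) u.2.
Definition away_add (z w : away) : away :=
  let u := generic_quotient.repr z in let v := generic_quotient.repr w in
  away_frac (u.1 * s ^+ v.2 + v.1 * s ^+ u.2) (u.2 + v.2).
Definition away_mul (z w : away) : away :=
  let u := generic_quotient.repr z in let v := generic_quotient.repr w in
  away_frac (u.1 * v.1) (u.2 + v.2).

Fact away_reprE a k : let u := generic_quotient.repr (away_frac a k) in
  exists m, s ^+ m * (u.1 * s ^+ k) = s ^+ m * (a * s ^+ u.2).
Proof.
by apply/away_fracP; rewrite {1}/away_frac -surjective_pairing reprK.
Qed.

Fact away_oppE a k : away_opp (away_frac a k) = away_frac (- a) k.
Proof.
have [m E] := away_reprE a k; apply/away_fracP; exists m.
by rewrite !mulNr !mulrN E.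
Qed.

Fact away_addE a k b l : away_add (away_frac a k) (away_frac b l) =
  away_frac (a * s ^+ l + b * s ^+ k) (k + l).
Proof.
rewrite /away_add; have [m E] := away_reprE a k; have [m' E'] := away_reprE b l.
move: (generic_quotient.repr (away_frac a k)) E => u /= E.
move: (generic_quotient.repr (away_frac b l)) E' => v /= E'.
apply/away_fracP; exists (m + m')%N; rewrite !exprD.
transitivity (s ^+ m' * s ^+ l * s ^+ v.2 * (s ^+ m * (u.1 * s ^+ k))
   + s ^+ m * s ^+ k * s ^+ u.2 * (s ^+ m' * (v.1 * s ^+ l))); first by ring.
by rewrite E E'; ring.
Qed.

Fact away_mulE a k b l :
  away_mul (away_frac a k) (away_frac b l) = away_frac (a * b) (k + l).
Proof.
rewrite /away_mul; have [m E] := away_reprE a k; have [m' E'] := away_reprE b l.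
move: (generic_quotient.repr (away_frac a k)) E => u /= E.
move: (generic_quotient.repr (away_frac b l)) E' => v /= E'.
apply/away_fracP; exists (m + m')%N; rewrite !exprD.
transitivity (s ^+ m * (u.1 * s ^+ k) * (s ^+ m' * (v.1 * s ^+ l))); first by ring.
by rewrite E E'; ring.
Qed.

Fact away_addA : associative away_add.
Proof.
move=> x y z; have [a [k ->]] := away_surj x; have [b [l ->]] := away_surj y.
have [c [m ->]] := away_surj z; rewrite !away_addE addnA.
by congr away_frac; rewrite !exprD; ring.
Qed.
Fact away_addC : commutative away_add.
Proof.
move=> x y; have [a [k ->]] := away_surj x; have [b [l ->]] := away_surj y.
by rewrite !away_addE addnC addrC.
Qed.
Fact away_add0 : left_id (away_frac 0 0) away_add.
Proof.
move=> x; have [a [k ->]] := away_surj x.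
by rewrite away_addE mul0r add0r mulr1.
Qed.
Fact away_addN : left_inverse (away_frac 0 0) away_opp away_add.
Proof.
move=> x; have [a [k ->]] := away_surj x; rewrite away_oppE away_addE.
by apply/away_fracP; exists 0; rewrite mulNr addNr !mul0r.
Qed.
HB.instance Definition _ :=
  GRing.isZmodule.Build away away_addA away_addC away_add0 away_addN.

Fact away_mulA : associative away_mul.
Proof.
move=> x y z; have [a [k ->]] := away_surj x; have [b [l ->]] := away_surj y.
by have [c [m ->]] := away_surj z; rewrite !away_mulE addnA mulrA.
Qed.
Fact away_mulC : commutative away_mul.
Proof.
move=> x y; have [a [k ->]] := away_surj x; have [b [l ->]] := away_surj y.
by rewrite !away_mulE addnC mulrC.
Qed.
Fact away_mul1 : left_id (away_frac 1 0) away_mul.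
Proof.
by move=> x; have [a [k ->]] := away_surj x; rewrite away_mulE mul1r.
Qed.
Fact away_mulDl : left_distributive away_mul +%R.
Proof.
move=> x y z; have [a [k ->]] := away_surj x; have [b [l ->]] := away_surj y.
have [c [m ->]] := away_surj z.
rewrite [_ + _ in LHS]away_addE !away_mulE [RHS]away_addE.
by apply/away_fracP; exists 0; rewrite !exprD; ring.
Qed.
HB.instance Definition _ := GRing.Zmodule_isComPzRing.Build away
  away_mulA away_mulC away_mul1 away_mulDl.

Lemma away_frac_opp a k : - away_frac a k = away_frac (- a) k.
Proof. exact: away_oppE. Qed.
Lemma away_frac_add a k b l : away_frac a k + away_frac b l =
  away_frac (a * s ^+ l + b * s ^+ k) (k + l).
Proof. exact: away_addE. Qed.
Lemma away_frac_mul a k b l :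
  away_frac a k * away_frac b l = away_frac (a * b) (k + l).
Proof. exact: away_mulE. Qed.

Definition to_away a := away_frac a 0.
Fact to_away_is_zmod : zmod_morphism to_away.
Proof.
by move=> a b; rewrite /to_away away_frac_opp away_frac_add !mulr1.
Qed.
Fact to_away_is_monoid : monoid_morphism to_away.
Proof. by split=> // a b; rewrite /to_away away_frac_mul. Qed.
HB.instance Definition _ :=
  GRing.isZmodMorphism.Build A away to_away to_away_is_zmod.
HB.instance Definition _ :=
  GRing.isMonoidMorphism.Build A away to_away to_away_is_monoid.

End Away.

Section AwayMap.
Variables (A B : comNzRingType) (s : A) (t : B) (f : {rmorphism A -> B}).
Hypothesis fs : f s = t.

Definition away_map of f s = t := fun z : away s =>
  let u := generic_quotient.repr z in away_frac t (f u.1) u.2.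

Lemma away_mapE a k : away_map fs (away_frac s a k) = away_frac t (f a) k.
Proof.
rewrite /away_map; have [m] := away_reprE s a k.
move: (generic_quotient.repr _) => u /= /(congr1 f).
by rewrite !(rmorphM, rmorphXn) fs => E; apply/away_fracP; exists m.
Qed.

Fact away_map_is_zmod : zmod_morphism (away_map fs).
Proof.
move=> x y; have [a [k ->]] := away_surj x; have [b [l ->]] := away_surj y.
rewrite away_frac_opp away_frac_add !away_mapE away_frac_opp away_frac_add.
by rewrite rmorphD !rmorphM !rmorphXn rmorphN fs.
Qed.
Fact away_map_is_monoid : monoid_morphism (away_map fs).
Proof.
split=> [|x y]; first by rewrite away_mapE rmorph1.
have [a [k ->]] := away_surj x; have [b [l ->]] := away_surj y.
by rewrite away_frac_mul !away_mapE away_frac_mul rmorphM.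
Qed.
HB.instance Definition _ :=
  GRing.isZmodMorphism.Build (away s) (away t) (away_map fs) away_map_is_zmod.
HB.instance Definition _ :=
  GRing.isMonoidMorphism.Build (away s) (away t) (away_map fs) away_map_is_monoid.

End AwayMap.

Section NumberField.
Variable F : splittingFieldType rat.

Definition ringint (a : F) : Prop := integralOver (intr : int -> F) a.

(* Every Z-basis of the ring of integers has the same discriminant, so at     *)
(* most one D satisfies this. For F Galois over Q, galTrace 1 {:F} is the     *)
(* trace from F to Q.                                                         *)
Definition is_discriminant (D : int) : Prop :=
  exists (d : nat) (b : 'I_d -> F),
  [/\ forall i, ringint (b i),
      forall a, ringint a ->
        exists! c : {ffun 'I_d -> int}, a = \sum_i b i *~ c i
    & \det (\matrix_(i, j) galTrace 1 {:F} (b i * b j)) = D%:~R].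

Definition ringint_away (M : int) (a : F) : Prop :=
  exists k : nat, ringint (M%:~R ^+ k * a).

Definition in_GL_away (M : int) (n : nat) (q : 'M[F]_n) : Prop :=
  [/\ q \in unitmx, forall i j, ringint_away M (q i j)
    & forall i j, ringint_away M (invmx q i j)].

Record prime_over (p : nat) := PrimeOver {
  prime_over_mem :> F -> Prop;
  prime_over_int : forall a, prime_over_mem a -> ringint a;
  prime_over0 : prime_over_mem 0;
  prime_overD : forall a b, prime_over_mem a -> prime_over_mem b -> prime_over_mem (a + b);
  prime_overM : forall a b, ringint a -> prime_over_mem b -> prime_over_mem (a * b);
  prime_over_proper : ~ prime_over_mem 1;
  prime_over_prime : forall a b, ringint a -> ringint b -> prime_over_mem (a * b) ->
    prime_over_mem a \/ prime_over_mem b;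
  prime_over_p : prime_over_mem p%:R
}.

Lemma galKV (s : gal_of {:F}) : cancel s (s^-1)%g.
Proof. by move=> a; rewrite -galM ?memvf // mulgV gal_id. Qed.
Lemma galVK (s : gal_of {:F}) : cancel (s^-1)%g s.
Proof. by move=> a; rewrite -galM ?memvf // mulVg gal_id. Qed.

Lemma ringint_gal (s : gal_of {:F}) a : ringint a -> ringint (s a).
Proof.
case=> P monP /eqP Pa; exists P => //; apply/eqP.
rewrite -[RHS](rmorph0 s) -{}Pa -horner_map; congr _.[_].
by rewrite -map_poly_comp; apply: eq_map_poly => m /=; rewrite rmorph_int.
Qed.

Local Obligation Tactic := idtac.

Section LocalRing.
Variable p : nat.

Program Definition gal_prime (s : gal_of {:F}) (P : prime_over p) :=
  @PrimeOver p (fun b => exists2 a, P a & b = s a) _ _ _ _ _ _ _.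
Next Obligation. by move=> s P _ [a Pa ->]; apply/ringint_gal/prime_over_int/Pa. Qed.
Next Obligation. by move=> s P; exists 0; rewrite ?rmorph0 //; apply: prime_over0. Qed.
Next Obligation.
move=> s P _ _ [a Pa ->] [b Pb ->]; exists (a + b); rewrite ?rmorphD //.
exact: prime_overD.
Qed.
Next Obligation.
move=> s P a _ Oa [b Pb ->]; exists ((s^-1)%g a * b).
  by apply: prime_overM => //; apply: ringint_gal.
by rewrite rmorphM /= galVK.
Qed.
Next Obligation.
move=> s P [a Pa E]; apply: (@prime_over_proper p P).
by rewrite (_ : 1 = a) //; apply: (can_inj (galKV s)); rewrite -E rmorph1.
Qed.
Next Obligation.
move=> s P a b Oa Ob [c Pc E].
have : P ((s^-1)%g a * (s^-1)%g b).
  by rewrite -rmorphM /= E galKV.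
case/prime_over_prime => [||Pa|Pb]; try exact: ringint_gal.
  by left; exists ((s^-1)%g a); rewrite ?galVK.
by right; exists ((s^-1)%g b); rewrite ?galVK.
Qed.
Next Obligation.
by move=> s P; exists p%:R; rewrite ?rmorph_nat //; apply: prime_over_p.
Qed.

Variable P : prime_over p.

Definition loc_mem : {pred F} := [pred x |
  `[< exists a b, [/\ ringint a, ringint b, ~ P b & x = a / b] >]].

Lemma loc_memP x :
  reflect (exists a b, [/\ ringint a, ringint b, ~ P b & x = a / b])
    (x \in loc_mem).
Proof. by rewrite inE; apply: asboolP. Qed.

Lemma notin_prime_neq0 b : ~ P b -> b != 0.
Proof. by move=> Pb; apply/eqP => b0; apply: Pb; rewrite b0; apply: prime_over0. Qed.

Fact loc_subring_closed : subring_closed loc_mem.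
Proof.
have PM b d : ringint b -> ringint d -> ~ P b -> ~ P d -> ~ P (b * d).
  by move=> Ob Od Pb Pd /(prime_over_prime Ob Od)[].
split.
- apply/loc_memP; exists 1, 1; rewrite divr1.
  by split=> //; [exact: integral1 | exact: integral1 | exact: prime_over_proper].
- move=> _ _ /loc_memP[a [b [Oa Ob Pb ->]]] /loc_memP[c [d [Oc Od Pd ->]]].
  apply/loc_memP; exists (a * d - c * b), (b * d); split.
  + by apply: integral_sub; apply: integral_mul.
  + exact: integral_mul.
  + exact: PM.
  + by field; rewrite !notin_prime_neq0.
- move=> _ _ /loc_memP[a [b [Oa Ob Pb ->]]] /loc_memP[c [d [Oc Od Pd ->]]].
  apply/loc_memP; exists (a * c), (b * d); split.
  + exact: integral_mul.
  + exact: integral_mul.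
  + exact: PM.
  + by rewrite mulf_div.
Qed.
HB.instance Definition _ := GRing.isSubringClosed.Build F loc_mem loc_subring_closed.

Record locring := Loc { locval : F; locvalP : locval \in loc_mem }.
HB.instance Definition _ := [isSub for locval].
HB.instance Definition _ := [Choice of locring by <:].
HB.instance Definition _ := [SubChoice_isSubComNzRing of locring by <:].

Lemma p_notunit (b : locring) : 1 <> b *+ p.
Proof.
move=> /(congr1 locval); rewrite -[locval]/(val) rmorph1 rmorphMn /=.
case: b => /= _ /loc_memP[a [b [Oa Ob Pb ->]]] E; apply: (Pb).
have -> : b = a * p%:R.
  apply: (mulIf (invr_neq0 (notin_prime_neq0 Pb))).
  by rewrite divff ?notin_prime_neq0 // mulrAC mulr_natr -E.
by apply: prime_overM => //; apply: prime_over_p.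
Qed.

Definition Rhat : Type := padic p locring.
HB.instance Definition _ := GRing.ComPzRing.on Rhat.
HB.instance Definition _ :=
  GRing.PzSemiRing_isNonZero.Build Rhat (padic_neq0 p_notunit).

(* Elements of F outside the local ring are sent to 0; the entries of q in    *)
(* O_F[1/M], with p not dividing M, are inside.                               *)
Definition to_Rhat (a : F) : Rhat := to_padic p (insubd (0 : locring) a).

End LocalRing.
End NumberField.

Section GaloisTransport.
Variables (F : splittingFieldType rat) (p : nat).
Variables (s : gal_of {:F}) (P : prime_over F p).

Fact loc_gal (x : locring P) : s (locval x) \in loc_mem (gal_prime s P).
Proof.
case: x => /= _ /loc_memP[a [b [Oa Ob Pb ->]]].
apply/loc_memP; exists (s a), (s b); rewrite fmorph_div; split=> //.
- exact: ringint_gal.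
- exact: ringint_gal.
- by case=> c Pc /(can_inj (galKV s)) bc; apply: Pb; rewrite bc.
Qed.

Fact loc_galV (y : locring (gal_prime s P)) : (s^-1)%g (locval y) \in loc_mem P.
Proof.
case: y => /= _ /loc_memP[a [b [Oa Ob Pb ->]]].
apply/loc_memP; exists ((s^-1)%g a), ((s^-1)%g b); rewrite fmorph_div; split=> //.
- exact: ringint_gal.
- exact: ringint_gal.
- by move=> Pc; apply: (Pb); exists ((s^-1)%g b); rewrite ?galVK.
Qed.

Definition gal_loc (x : locring P) : locring (gal_prime s P) := Loc (loc_gal x).
Definition gal_locV (y : locring (gal_prime s P)) : locring P := Loc (loc_galV y).

Fact gal_loc_is_zmod : zmod_morphism gal_loc.
Proof. by move=> x y; apply: val_inj; rewrite /= -!/(val _) !raddfB. Qed.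
Fact gal_loc_is_monoid : monoid_morphism gal_loc.
Proof.
by split=> [|x y]; apply: val_inj; rewrite /= -!/(val _) ?rmorph1 ?rmorphM.
Qed.
HB.instance Definition _ :=
  GRing.isZmodMorphism.Build _ _ gal_loc gal_loc_is_zmod.
HB.instance Definition _ :=
  GRing.isMonoidMorphism.Build _ _ gal_loc gal_loc_is_monoid.

Fact gal_locV_is_zmod : zmod_morphism gal_locV.
Proof. by move=> x y; apply: val_inj; rewrite /= -!/(val _) !raddfB. Qed.
Fact gal_locV_is_monoid : monoid_morphism gal_locV.
Proof.
by split=> [|x y]; apply: val_inj; rewrite /= -!/(val _) ?rmorph1 ?rmorphM.
Qed.
HB.instance Definition _ :=
  GRing.isZmodMorphism.Build _ _ gal_locV gal_locV_is_zmod.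
HB.instance Definition _ :=
  GRing.isMonoidMorphism.Build _ _ gal_locV gal_locV_is_monoid.

Lemma gal_locK : cancel gal_loc gal_locV.
Proof. by move=> x; apply: val_inj; rewrite /= galKV. Qed.
Lemma gal_locVK : cancel gal_locV gal_loc.
Proof. by move=> x; apply: val_inj; rewrite /= galVK. Qed.

Definition gal_Rhat : {rmorphism Rhat P -> Rhat (gal_prime s P)} :=
  padic_map (p:=p) gal_loc.
Definition gal_RhatV : {rmorphism Rhat (gal_prime s P) -> Rhat P} :=
  padic_map (p:=p) gal_locV.

Lemma gal_RhatK : cancel gal_Rhat gal_RhatV.
Proof. exact: padic_mapK gal_locK. Qed.
Lemma gal_RhatVK : cancel gal_RhatV gal_Rhat.
Proof. exact: padic_mapK gal_locVK. Qed.

End GaloisTransport.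

(* R[x, 1/det x]^, with the n^2 indeterminates indexed by mxvec_index. *)
Definition polyx (R : comNzRingType) (n : nat) : 'M[{mpoly R[n * n]}]_n :=
  \matrix_(i, j) 'X_(mxvec_index i j).

Section Ghat.
Variables (p n : nat) (R : comNzRingType).

Definition detx : {mpoly R[n * n]} := \det (polyx R n).
Definition Ghat : Type := padic p (away detx).
HB.instance Definition _ := GRing.ComPzRing.on Ghat.

Definition poly_to_Ghat (f : {mpoly R[n * n]}) : Ghat :=
  to_padic p (to_away detx f).
HB.instance Definition _ := GRing.RMorphism.copy poly_to_Ghat
  (@to_padic p _ \o to_away detx).

Definition Ghat_cst (a : R) : Ghat := poly_to_Ghat a%:MP.
HB.instance Definition _ := GRing.RMorphism.copy Ghat_cst
  (poly_to_Ghat \o mpolyC (n * n) (R:=R)).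

Definition Ghat_x : 'M[Ghat]_n := map_mx poly_to_Ghat (polyx R n).

End Ghat.

Section GhatMap.
Variables (p n : nat) (R S : comNzRingType) (f : {rmorphism R -> S}).

Fact map_detx : map_mpoly f (detx n R) = detx n S.
Proof.
rewrite /detx -det_map_mx; congr (\det _).
by apply/matrixP=> i j; rewrite !mxE /= map_mpolyX.
Qed.

Definition Ghat_map : {rmorphism Ghat p n R -> Ghat p n S} :=
  padic_map (p:=p) (away_map map_detx).

Lemma Ghat_map_poly g :
  Ghat_map (poly_to_Ghat p g) = poly_to_Ghat p (map_mpoly f g).
Proof. by rewrite /= padic_map_to /= away_mapE. Qed.

Lemma Ghat_map_cst a : Ghat_map (Ghat_cst p n a) = Ghat_cst p n (f a).
Proof. by rewrite [LHS]Ghat_map_poly map_mpolyC. Qed.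

Lemma Ghat_map_x : map_mx Ghat_map (Ghat_x p n R) = Ghat_x p n S.
Proof.
apply/matrixP=> i j; rewrite !mxE Ghat_map_poly; congr (poly_to_Ghat _ _).
by rewrite /= map_mpolyX.
Qed.

End GhatMap.

Lemma Ghat_mapK p n (R S : comNzRingType)
  (f : {rmorphism R -> S}) (g : {rmorphism S -> R}) :
  cancel f g -> cancel (Ghat_map p n f) (Ghat_map p n g).
Proof.
move=> fK; apply: padic_mapK => z; have [a [k ->]] := away_surj z.
rewrite /= !away_mapE; congr away_frac; apply/mpolyP => m.
by rewrite !mcoeff_map_mpoly /= fK.
Qed.

Section Frobenius.
Variables (p : nat) (A : comPzRingType).

Definition eq_mod (a b : A) : Prop := exists c, a - b = c *+ p.

Definition ring_endo (f : A -> A) : Prop := zmod_morphism f /\ monoid_morphism f.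

Definition frobenius_lift (f : A -> A) : Prop :=
  ring_endo f /\ forall a, eq_mod (f a) (a ^+ p).

Definition attached (delta : A -> A) : A -> A := fun a => a ^+ p + delta a *+ p.

(* All rings to which this is applied are p-torsion free, where the identities *)
(* defining p-derivations say exactly that the attached map is a ring         *)
(* endomorphism (it then is a Frobenius lift).                                *)
Definition p_derivation (delta : A -> A) : Prop := ring_endo (attached delta).

Definition frob_mx m n k (a : 'M[A]_(m, n)) : 'M[A]_(m, n) :=
  map_mx (fun c => c ^+ (p ^ k)) a.

End Frobenius.

Section Connection.
Variables (F : splittingFieldType rat) (p n : nat).
Variables (sigma : 'I_n -> gal_of {:F}) (P : prime_over F p) (q : 'M[F]_n).

Definition OG (Q : prime_over F p) : Type := Ghat p n (Rhat Q).
HB.instance Definition _ Q := GRing.ComPzRing.on (OG Q).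

Definition OG_cst (Q : prime_over F p) : Rhat Q -> OG Q := @Ghat_cst p n (Rhat Q).
Definition OG_x (Q : prime_over F p) : 'M[OG Q]_n := Ghat_x p n (Rhat Q).
Definition OG_q (Q : prime_over F p) : 'M[OG Q]_n :=
  map_mx (fun a => OG_cst (to_Rhat Q a)) q.

Local Notation Pi i := (gal_prime (sigma i) P).

(* As sigma_1 = id, O(G^1) is OG P; sigma_i goes from OG P to OG (Pi i).      *)
Definition sigmaG i : {rmorphism OG P -> OG (Pi i)} :=
  Ghat_map p n (gal_Rhat (sigma i) P).
Definition sigmaGV i : {rmorphism OG (Pi i) -> OG P} :=
  Ghat_map p n (gal_RhatV (sigma i) P).

Lemma sigmaGK i : cancel (sigmaG i) (sigmaGV i).
Proof. exact/Ghat_mapK/gal_RhatK. Qed.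
Lemma sigmaGVK i : cancel (sigmaGV i) (sigmaG i).
Proof. exact/Ghat_mapK/gal_RhatVK. Qed.

Variable delta : forall i, OG (Pi i) -> OG (Pi i).

Definition vertical_connection : Prop :=
  forall i, p_derivation p (@delta i) /\
    exists2 d : Rhat (Pi i) -> Rhat (Pi i), p_derivation p d &
      forall a, delta (OG_cst a) = OG_cst (d a).

Definition phi i : OG (Pi i) -> OG (Pi i) := attached p (@delta i).

(* Ring endomorphisms are p-adically continuous, so the next two predicates   *)
(* determine a unique map.                                                    *)
Definition is_H (Q : prime_over F p) (H : OG Q -> OG Q) : Prop :=
  [/\ ring_endo H, forall a, H (OG_cst a) = OG_cst a
    & map_mx H (OG_x Q) = (OG_x Q)^T *m OG_q Q *m OG_x Q].

Definition is_phi0 (Q : prime_over F p) (phi0 : OG Q -> OG Q) : Prop :=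
  [/\ frobenius_lift p phi0,
      exists2 f : Rhat Q -> Rhat Q, frobenius_lift p f &
        forall a, phi0 (OG_cst a) = OG_cst (f a)
    & map_mx phi0 (OG_x Q) = frob_mx p 1 (OG_x Q)].

Definition metric : Prop :=
  forall i, exists H phi0 : OG (Pi i) -> OG (Pi i),
    [/\ is_H H, is_phi0 phi0 & phi (i:=i) \o H =1 H \o phi0].

Definition gamma i : 'M[OG (Pi i)]_n :=
  (map_mx (@delta i) (OG_x (Pi i)))^T *m map_mx (@phi i) (OG_q (Pi i))
    *m frob_mx p 1 (OG_x (Pi i)).

Definition torsion_free : Prop :=
  forall i j k, sigmaGV i (gamma i j k) = sigmaGV j (gamma j i k).

(* Such a delta is unique; hence universal quantification over all delta with *)
(* this property speaks about the vertical Levi-Civita connection.            *)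
Definition is_levi_civita : Prop :=
  [/\ vertical_connection, metric & torsion_free].

Definition psi i : OG P -> OG P := sigmaGV i \o @phi i \o sigmaG i.

(* O(G^1) being p-torsion free, the division by p is unambiguous. *)
Definition is_curvature (varphi : 'I_n -> 'I_n -> OG P -> OG P) : Prop :=
  forall i j f, varphi i j f *+ p = psi i (psi j f) - psi j (psi i f).

Definition riemann (varphi : 'I_n -> 'I_n -> OG P -> OG P) (i j m k : 'I_n) : OG P :=
  ((frob_mx p 2 (OG_x P))^T *m frob_mx p 2 (OG_q P)
    *m map_mx (varphi i j) (OG_x P)) m k.

End Connection.

(* Main.v *)
Require Import Defs.
From HB Require Import structures.
From mathcomp Require Import all_boot all_order all_fingroup all_algebra all_field.
From mathcomp Require Import ring zify.
From mathcomp Require Import boolp mpoly.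

(* Pulled back to O(G^1), the Frobenius lifts become                          *)
(* psi_i(a) = a^p + p delta_i(a). In pPhi_ij = psi_i psi_j x - psi_j psi_i x  *)
(* the terms (x^(p) + p delta_i x)^(p) agree with x^(p^2) mod p^2, so         *)
(* Phi_ij = (delta_j x)^(p) - (delta_i x)^(p) mod p. Hence, with g_ijk the    *)
(* p-th power of gamma_ijk, R_ijmk = g_jkm - g_ikm mod p. Torsion freeness    *)
(* says g_ijk = g_jik; expanding the metric condition mod p^2 shows that      *)
(* h_jk = g_ijk + g_ikj does not depend on i. So g is given by the formula    *)
(* for Christoffel symbols, 2 g_ijk = h_jk + h_ik - h_ij, whence              *)
(* 2 R_ijmk = h_jm + h_ik - h_jk - h_im, from which the symmetries are        *)
(* visible.                                                                   *)
(*                                                                            *)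
(* The expansion needs psi_i(q) mod p^2 to be independent of i, which holds   *)
(* as soon as the entries of q are p-th powers mod p. This follows from       *)
(* O_F/p being perfect: it is reduced because the trace form is nondegenerate *)
(* mod p, and it is finite.                                                   *)

Set Implicit Arguments.
Unset Strict Implicit.
Unset Printing Implicit Defensive.

Import GRing.Theory.
Local Open Scope ring_scope.

(** The proof separates algebra from arithmetic. The algebra is [riemann_symmetries], about
    Frobenius lifts on one p-torsion free ring and a symmetric q whose entries are p-th powers mod
    p. It rests on [gam_sym_bar] (the metric condition), [christoffel] (which adds torsion freeness)
    and [riemann_bar] (curvature in terms of g). The arithmetic supplies the hypotheses: conjugation
    by sigma_i moves every lift to O(G^1), where gauge invariance identifies all copies of q
    ([metric_pulled], [gamma_pulled]); [torsionfree_OG] permits division by p; [OG_q_perfect] holds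
    since p does not divide the discriminant; p is odd since M is even, so 2 cancels mod p. *)

(** * p-torsion freeness of O(G) *)

Definition torsionfree (p : nat) (A : zmodType) : Prop :=
  forall a : A, a *+ p = 0 -> a = 0.

Lemma torsionfree_inj p (A : zmodType) :
  torsionfree p A -> injective (fun a : A => a *+ p).
Proof.
by move=> tf a b /eqP; rewrite -subr_eq0 -mulrnBl => /eqP/tf/eqP; rewrite subr_eq0 => /eqP.
Qed.

(** Coordinate k+1 controls coordinate k: if a represents both and pa = p^(k+1) c, then a = p^k
    c. *)
Lemma torsionfree_padic p (A : comPzRingType) :
  torsionfree p A -> torsionfree p (padic p A).
Proof.
move=> tf x xp0; apply: padic_eq => k.
have [a [-> Ea]] := padic_coordP x k.
have : padic_coord (x *+ p) k.+1 = pi_modpow p k.+1 0 by rewrite xp0.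
have -> m : padic_coord (x *+ m) k.+1 = padic_coord x k.+1 *+ m.
  by elim: m => [|m IH]; rewrite ?mulr0n /= ?rmorph0 // !mulrS /= IH.
rewrite Ea -rmorphMn => /pi_modpowP[c]; rewrite add0r expnSr mulrnA.
move/(torsionfree_inj tf) => ->.
by apply/pi_modpowP; exists c; rewrite add0r.
Qed.

Lemma torsionfree_mpoly p n (R : comNzRingType) :
  torsionfree p R -> torsionfree p {mpoly R[n]}.
Proof.
move=> tf f fp0; apply/mpolyP => m; rewrite mcoeff0; apply: tf.
by rewrite -mcoeffMn fp0 mcoeff0.
Qed.

Lemma away_fracMn (A : comNzRingType) (s a : A) k m :
  away_frac s a k *+ m = away_frac s (a *+ m) k.
Proof.
elim: m => [|m IH].
  by rewrite !mulr0n; apply/away_fracP; exists 0; rewrite !mul0r.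
rewrite mulrS IH away_frac_add mulrS; apply/away_fracP; exists 0.
by rewrite !exprD; ring.
Qed.

Lemma torsionfree_away p (A : comNzRingType) (s : A) :
  torsionfree p A -> torsionfree p (away s).
Proof.
move=> tf z; have [a [k ->]] := away_surj z; rewrite away_fracMn.
case/(away_fracP s _ _ 0 0) => m.
rewrite mul0r mulr0 expr0 mulr1 mulrnAr => /tf E.
by apply/away_fracP; exists m; rewrite mul0r mulr0 expr0 mulr1.
Qed.

Lemma torsionfree_locring (F : splittingFieldType rat) p (P : prime_over F p) :
  prime p -> torsionfree p (locring P).
Proof.
move=> p_pr a /(congr1 val); rewrite rmorph0 rmorphMn /= => /eqP.
rewrite -mulr_natr mulf_eq0 => /orP[/eqP a0|p0].
  by apply: val_inj; rewrite rmorph0.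
have : p \in [pchar F] by rewrite inE p_pr p0.
by rewrite pchar_lalg Num.Theory.pchar_num.
Qed.

Lemma torsionfree_OG (F : splittingFieldType rat) p n (P : prime_over F p) :
  prime p -> torsionfree p (OG n P).
Proof.
move=> p_pr; apply/torsionfree_padic/torsionfree_away/torsionfree_mpoly.
exact/torsionfree_padic/torsionfree_locring.
Qed.

(** * Frobenius mod p and p-th powers mod p^2 *)

Lemma ring_endo_rmorphism (A : comPzRingType) (f : A -> A) :
  ring_endo f -> exists g : {rmorphism A -> A}, f = g.
Proof.
move=> [fB fM]; pose mB := GRing.isZmodMorphism.Build A A f fB.
pose mM := GRing.isMonoidMorphism.Build A A f fM.
by exists (HB.pack_for {rmorphism A -> A} f mB mM).
Qed.

Lemma map_frob_mx p k m n (A B : comPzRingType) (f : {rmorphism A -> B}) (M : 'M_(m, n)) :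
  map_mx f (frob_mx p k M) = frob_mx p k (map_mx f M).
Proof. by apply/matrixP => i j; rewrite !mxE rmorphXn. Qed.

Lemma modpow1_pchar p (A : comPzRingType) (z : modpow p A 1) : z *+ p = 0.
Proof.
have [a ->] := modpow_surj z; rewrite -rmorphMn -(rmorph0 (pi_modpow p 1)).
by apply/pi_modpowP; exists a; rewrite add0r.
Qed.

Lemma eq_modP p (A : comPzRingType) (a b : A) :
  eq_mod p a b <-> pi_modpow p 1 a = pi_modpow p 1 b.
Proof.
rewrite pi_modpowP; split=> -[c E]; exists c.
  by rewrite expn1 -E addrC subrK.
by rewrite E expn1 addrAC subrr add0r.
Qed.

Lemma exprD_pchar p (B : comPzRingType) (a b : B) : prime p ->
  (forall z : B, z *+ p = 0) -> (a + b) ^+ p = a ^+ p + b ^+ p.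
Proof.
move=> p_pr pB0; have defp := prednK (prime_gt0 p_pr).
rewrite exprDn big_ord_recr subnn -defp big_ord_recl /= defp.
rewrite subn0 mulr1 mul1r bin0 binn big1 ?addr0 // => i _.
have /dvdnP[m ->] : (p %| 'C(p, bump 0 i))%N.
  by rewrite prime_dvd_bin //= /bump add1n /= -{2}defp ltnS (valP i).
by rewrite mulrnA pB0.
Qed.

(* The unused argument p_pr makes the morphism instances below inferable. *)
Definition frob p (p_pr : prime p) (A : comPzRingType) : modpow p A 1 -> modpow p A 1 :=
  fun z => z ^+ p.

Section FrobeniusMorphism.
Variables (p : nat) (p_pr : prime p) (A : comPzRingType).

Fact frob_is_zmod : zmod_morphism (@frob p p_pr A).
Proof.
move=> a b; apply/eqP; rewrite eq_sym subr_eq /frob -exprD_pchar ?subrK //.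
exact: modpow1_pchar.
Qed.
Fact frob_is_monoid : monoid_morphism (@frob p p_pr A).
Proof. by split=> [|a b]; rewrite /frob ?expr1n ?exprMn. Qed.
HB.instance Definition _ := GRing.isZmodMorphism.Build _ _ _ frob_is_zmod.
HB.instance Definition _ := GRing.isMonoidMorphism.Build _ _ _ frob_is_monoid.

End FrobeniusMorphism.

Lemma exprD_modp2 p (A : comPzRingType) (a b : A) :
  exists c, (a + b *+ p) ^+ p = a ^+ p + c *+ p ^ 2.
Proof.
(* Binomial expansion to first order in P. With P and the exponent both equal to p, the linear term
   also carries p^2. *)
have E (P : A) m : exists c,
    (a + b * P) ^+ m.+1 = a ^+ m.+1 + a ^+ m * b * m.+1%:R * P + c * P ^+ 2.
  elim: m => [|m [c E]]; first by exists 0; rewrite !expr1 expr0; ring.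
  exists (a ^+ m * b * b * m.+1%:R + a * c + b * c * P).
  by rewrite exprS E -(natr1 m.+1) !exprS; move: m.+1%:R => M; ring.
case: p => [|m]; first by exists 0; rewrite !expr0 mul0rn addr0.
have [c] := E m.+1%:R m; rewrite mulr_natr => ->.
exists (a ^+ m * b + c); rewrite -natrX !mulr_natr mulrnDl addrA -mulrnA.
by rewrite mulnn.
Qed.

(** * Symmetries of the curvature for Frobenius lifts on a single ring *)

Section CurvatureModP.
Variables (p : nat) (p_pr : prime p) (p_odd : odd p) (A : comPzRingType).
Hypothesis A_tf : torsionfree p A.
Variables (n : nat) (delta : 'I_n -> A -> A).
Hypothesis deltaP : forall i, p_derivation p (delta i).
Variables (x q : 'M[A]_n).
Hypothesis q_sym : q^T = q.
Hypothesis q_perfect : forall i j, exists b c, q i j = b ^+ p + c *+ p.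

Local Notation psi i := (attached p (delta i)).
Local Notation bar := (pi_modpow p 1).
Local Notation Fr := (@frob p p_pr A).
Let dx i := map_mx (delta i) x.
Let Q i := map_mx (psi i) q.
Let xp := frob_mx p 1 x.

Hypothesis metricP : forall i,
  (map_mx (psi i) x)^T *m Q i *m map_mx (psi i) x = frob_mx p 1 (x^T *m q *m x).

Let gam i := (dx i)^T *m Q i *m xp.
Hypothesis torsion_freeP : forall i j k, gam i j k = gam j i k.

Lemma attachedD i : {morph psi i : a b / a + b}.
Proof. by have [g ->] := ring_endo_rmorphism (deltaP i); apply: rmorphD. Qed.

Lemma attachedMn i a m : psi i (a *+ m) = psi i a *+ m.
Proof. by have [g ->] := ring_endo_rmorphism (deltaP i); apply: rmorphMn. Qed.

Lemma attachedX i a m : psi i (a ^+ m) = psi i a ^+ m.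
Proof. by have [g ->] := ring_endo_rmorphism (deltaP i); apply: rmorphXn. Qed.

Lemma attached_expp i a : exists c, psi i (a ^+ p) = a ^+ (p ^ 2) + c *+ p ^ 2.
Proof.
rewrite attachedX; have [c ->] := exprD_modp2 p (a ^+ p) (delta i a).
by exists c; rewrite -exprM mulnn.
Qed.

Lemma bar_attached i a : bar (psi i a) = Fr (bar a).
Proof. by rewrite rmorphD rmorphMn modpow1_pchar addr0 rmorphXn. Qed.

Lemma curvature_bar i j (f v : A) :
  v *+ p = psi i (psi j f) - psi j (psi i f) ->
  bar v = Fr (bar (delta j f)) - Fr (bar (delta i f)).
Proof.
have E k l : exists c, psi k (psi l f)
    = f ^+ (p ^ 2) + psi k (delta l f) *+ p + c *+ p ^ 2.
  rewrite attachedD attachedMn; have [c ->] := attached_expp k f.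
  by exists c; rewrite addrAC.
have [[c ->] [d ->]] := (E i j, E j i) => vE.
have {vE} -> : v = psi i (delta j f) - psi j (delta i f) + (c - d) *+ p.
  apply: (torsionfree_inj A_tf); rewrite /= vE.
  move: (psi i _) (psi j _) (f ^+ _) => X Y U.
  rewrite !(mulrnDl, mulNrn) -!mulrnA mulnn.
  move: (X *+ _) (Y *+ _) (c *+ _) (d *+ _) => X' Y' C D; ring.
by rewrite rmorphD rmorphMn modpow1_pchar addr0 rmorphB /= !bar_attached.
Qed.

(** If an entry of q is u^p + pv, its image under psi_i is u^(p^2) + p v^p mod p^2, which does not
    involve i. *)
Lemma attached_q_modp2 i j : exists E, Q i = Q j + E *+ p ^ 2.
Proof.
have qE a b : exists c, Q i a b = Q j a b + c *+ p ^ 2.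
  have [u [v E]] := q_perfect a b; rewrite !mxE E !attachedD !attachedMn.
  have [[c ->] [d ->]] := (attached_expp i u, attached_expp j u).
  exists (c - d + delta i v - delta j v).
  rewrite /attached !(mulrnDl, mulNrn) -!mulrnA mulnn.
  move: (u ^+ _) (v ^+ _ *+ _) (c *+ _) (d *+ _) (delta i v *+ _) (delta j v *+ _).
  by move=> U V C D X Y; ring.
have [E EP] := choice (fun ab : 'I_n * 'I_n => qE ab.1 ab.2).
exists (\matrix_(a, b) E (a, b)); apply/matrixP => a b.
by rewrite [LHS](EP (a, b)) [RHS]mxE mulmxnE; congr (_ + _ *+ _); rewrite mxE.
Qed.

Lemma tr_Q i : (Q i)^T = Q i.
Proof. by apply/matrixP => a b; rewrite !mxE -[in LHS]q_sym mxE. Qed.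

Lemma tr_gam i : (gam i)^T = xp^T *m Q i *m dx i.
Proof. by rewrite /gam !trmx_mul trmxK tr_Q mulmxA. Qed.

(** Substitute psi_i(x) = x^(p) + p delta_i(x) into [metricP]; as [Q i] is symmetric, the two cross
    terms are [gam i] and its transpose. *)
Lemma metric_expansion i : exists E,
  frob_mx p 1 (x^T *m q *m x) = xp^T *m Q i *m xp + (gam i + (gam i)^T) *+ p + E *+ p ^ 2.
Proof.
exists ((dx i)^T *m Q i *m dx i); rewrite -(metricP i).
have -> : map_mx (psi i) x = xp + dx i *+ p.
  by apply/matrixP => a b; rewrite [RHS]mxE mulmxnE !mxE expn1.
rewrite tr_gam -!scaler_nat natrX expr2 -!scalerA [(xp + _)^T]linearD /= [(_ *: dx i)^T]linearZ /=.
rewrite !mulmxDl !mulmxDr -!scalemxAl -!scalemxAr.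
by rewrite [gam i + _]addrC scalerDr !addrA.
Qed.

(** The expansions for i and j have the same left-hand side, and [Q i] agrees with [Q j] mod p^2;
    what remains is divided by p. *)
Lemma gam_sym_bar i j a b :
  bar (gam i a b + gam i b a) = bar (gam j a b + gam j b a).
Proof.
have [E Ei] := metric_expansion i; have [E' Ej] := metric_expansion j.
have [D Dij] := attached_q_modp2 i j; move: Ei; rewrite {}Ej Dij => Eij.
apply/pi_modpowP.
exists ((E' - E - xp^T *m D *m xp) a b); rewrite expn1; apply: (torsionfree_inj A_tf) => /=.
move/matrixP/(_ a b): Eij.
rewrite -(scaler_nat _ D) mulmxDr mulmxDl -scalemxAr -scalemxAl scaler_nat.
move: (xp^T *m D *m xp) (xp^T *m Q j *m xp) (gam i) (gam j) => X Y Gi Gj.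
rewrite !(mxE, mulmxnE) !mulrnDl -!mulrnA mulnn !mulNrn.
move: (X a b *+ _) (E a b *+ _) (E' a b *+ _) => X' e e'.
move: (Gi a b *+ _ + _) (Gj a b *+ _ + _) (Y a b) => u v y H.
have -> : u = y + X' + u + e - y - X' - e by ring.
by rewrite -H; ring.
Qed.

Let g i j k : modpow p A 1 := Fr (bar (gam i j k)).

Lemma modpow1_double (a : modpow p A 1) : a *+ 2 = 0 -> a = 0.
Proof.
move=> a0; rewrite -[RHS](modpow1_pchar a).
have E : p = (1 + 2 * p./2)%N by rewrite mul2n -[LHS]odd_double_half p_odd.
by rewrite [X in _ *+ X]E mulrnDr mulrnA a0 mul0rn addr0.
Qed.

(** The index [i0] only serves to write h down: by [gam_sym_bar] any other index gives the same
    h. *)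
Lemma christoffel (i0 : 'I_n) : exists h : 'I_n -> 'I_n -> modpow p A 1,
  (forall i j, h i j = h j i) /\
  forall i j k, g i j k *+ 2 = h j k + h i k - h i j.
Proof.
have gs i j k : g i j k = g j i k by rewrite /g torsion_freeP.
have gh i j k : g i j k + g i k j = g i0 j k + g i0 k j.
  by rewrite /g -!rmorphD /= (gam_sym_bar i i0).
exists (fun j k => g i0 j k + g i0 k j); split=> [i j|i j k]; first exact: addrC.
rewrite -(gh i j k) -(gh j i k) -(gh k i j) (gs j i k) (gs k i j) (gs k j i).
move: (g i j k) (g i k j) (g j k i) => u v w; ring.
Qed.

Lemma riemann_bar (varphi : 'I_n -> 'I_n -> A -> A) :
  (forall i j f, varphi i j f *+ p = psi i (psi j f) - psi j (psi i f)) ->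
  forall i j m k,
  bar (((frob_mx p 2 x)^T *m frob_mx p 2 q *m map_mx (varphi i j) x) m k)
    = g j k m - g i k m.
Proof.
move=> varphiP i j m k.
have barxp : map_mx bar xp = map_mx Fr (map_mx bar x).
  by apply/matrixP => a b; rewrite !mxE expn1 rmorphXn.
have barQ l : map_mx bar (Q l) = map_mx Fr (map_mx bar q).
  by apply/matrixP => a b; rewrite !mxE bar_attached.
have Fr2 (M : 'M[A]_n) : map_mx bar (frob_mx p 2 M) = map_mx Fr (map_mx Fr (map_mx bar M)).
  by apply/matrixP => a b; rewrite !mxE rmorphXn /= /frob -exprM mulnn.
(* Mod p, [Q l] is q^(p), so one more Frobenius yields the factors x^(p^2)t and q^(p^2) of the
   curvature. The transpose explains the order k, m of the indices of g. *)
have gE l : map_mx Fr (map_mx bar (gam l)^T) =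
    map_mx bar ((frob_mx p 2 x)^T *m frob_mx p 2 q) *m map_mx Fr (map_mx bar (dx l)).
  by rewrite tr_gam !map_mxM -!matrix.map_trmx barxp barQ !Fr2.
have g_mxE l : g l k m = map_mx Fr (map_mx bar (gam l)^T) m k.
  by rewrite [RHS]mxE [map_mx bar _ _ _]mxE [_^T _ _]mxE.
rewrite !g_mxE !gE.
have -> (M : 'M[A]_n) : bar (M m k) = map_mx bar M m k by rewrite mxE.
have -> (M N : 'M[modpow p A 1]_n) : M m k - N m k = (M - N) m k by rewrite !mxE.
rewrite -mulmxBr map_mxM; congr ((_ *m _) m k).
by apply/matrixP => a b; rewrite !mxE; exact: (curvature_bar (varphiP i j _)).
Qed.

Lemma riemann_symmetries (varphi : 'I_n -> 'I_n -> A -> A) :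
  (forall i j f, varphi i j f *+ p = psi i (psi j f) - psi j (psi i f)) ->
  let R i j m k :=
    ((frob_mx p 2 x)^T *m frob_mx p 2 q *m map_mx (varphi i j) x) m k in
  forall i j k m : 'I_n,
  [/\ eq_mod p (R i j k m) (- R i j m k),
      eq_mod p (R i j k m) (- R j i k m),
      eq_mod p (R m i j k + R m j k i + R m k i j) 0
    & eq_mod p (R i j k m) (R k m i j)].
Proof.
move=> varphiP R i j k m; have [h [h_sym gh]] := christoffel i.
have RE a b c d : bar (R a b c d) = g b d c - g a d c by exact: riemann_bar.
have eq2 (u v : modpow p A 1) : u *+ 2 = v *+ 2 -> u = v.
  move=> E; apply/eqP; rewrite -subr_eq0; apply/eqP/modpow1_double.
  by rewrite mulrnBl E subrr.
(* Up to sign, the Kulkarni-Nomizu product of h with the all-ones form; such products have every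
   symmetry of a curvature tensor. *)
have R2 a b c d : bar (R a b c d) *+ 2 = h b c + h a d - h b d - h a c.
  rewrite RE mulrnBl !gh.
  by move: (h b d) (h b c) (h a d) (h a c) (h d c) => *; ring.
split; apply/eq_modP/eq2;
  rewrite ?rmorphD ?rmorphN ?rmorph0 /= ?mulrnDl ?mulNrn ?mul0rn ?R2.
- by move: (h j k) (h i m) (h j m) (h i k) => *; ring.
- by move: (h j k) (h i m) (h j m) (h i k) => *; ring.
- rewrite (h_sym k j) (h_sym i k) (h_sym j i).
  by move: (h j k) (h i k) (h i j) (h m i) (h m j) (h m k) => *; ring.
- rewrite (h_sym m i) (h_sym k j) (h_sym m j) (h_sym k i).
  by move: (h j k) (h i m) (h j m) (h i k) => *; ring.
Qed.
End CurvatureModP.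

(** * Perfectness of the ring of integers modulo an unramified prime *)

Section RingOfIntegers.
Variable F : splittingFieldType rat.

Definition ringint_mem : {pred F} := [pred a | `[< ringint a >]].

Lemma ringint_memP a : reflect (ringint a) (a \in ringint_mem).
Proof. by rewrite inE; apply: asboolP. Qed.

Fact ringint_subring_closed : subring_closed ringint_mem.
Proof.
split=> [|a b /ringint_memP Oa /ringint_memP Ob|a b /ringint_memP Oa /ringint_memP Ob];
  apply/ringint_memP.
- exact: integral1.
- exact: integral_sub.
- exact: integral_mul.
Qed.
HB.instance Definition _ :=
  GRing.isSubringClosed.Build F ringint_mem ringint_subring_closed.

(** O_F as a ring type, so that [modpow p intring 1] is O_F/p. *)
Record intring := IntRing { intval : F; intvalP : intval \in ringint_mem }.
HB.instance Definition _ := [isSub for intval].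
HB.instance Definition _ := [Choice of intring by <:].
HB.instance Definition _ := [SubChoice_isSubComNzRing of intring by <:].

Lemma intval_ringint (a : intring) : ringint (val a).
Proof. exact/ringint_memP/intvalP. Qed.

Definition to_intring a (Oa : ringint a) : intring := IntRing (introT (ringint_memP a) Oa).

Definition gal_int (s : gal_of {:F}) (a : intring) : intring :=
  to_intring (ringint_gal s (intval_ringint a)).

Fact gal_int_is_zmod s : zmod_morphism (gal_int s).
Proof. by move=> a b; apply: val_inj; rewrite /= -!/(val _) !raddfB. Qed.
Fact gal_int_is_monoid s : monoid_morphism (gal_int s).
Proof. by split=> [|a b]; apply: val_inj; rewrite /= -!/(val _) ?rmorph1 ?rmorphM. Qed.
HB.instance Definition _ s := GRing.isZmodMorphism.Build _ _ _ (gal_int_is_zmod s).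
HB.instance Definition _ s := GRing.isMonoidMorphism.Build _ _ _ (gal_int_is_monoid s).

Definition trace_int (a : intring) : intring :=
  \sum_(s in 'Gal({:F} / 1)%g) gal_int s a.

Fact trace_int_is_zmod : zmod_morphism trace_int.
Proof. by move=> a b; rewrite -sumrB; apply: eq_bigr => s _; rewrite raddfB. Qed.
HB.instance Definition _ := GRing.isZmodMorphism.Build _ _ _ trace_int_is_zmod.

Lemma val_trace_int a : val (trace_int a) = galTrace 1 {:F} (val a).
Proof. by rewrite raddf_sum. Qed.

Section Perfect.
Variables (p : nat) (p_pr : prime p) (P : prime_over F p).

(** Otherwise a Bezout relation makes p invertible in O_F, and then 1 lies in P. *)
Lemma dvdz_intring (m : int) (z : intring) : m%:~R = z *+ p -> (p %| m)%Z.
Proof.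
move=> mz; apply/negPn/negP => pNm; apply: (@prime_over_proper _ _ P).
have /coprimezP[[u v] /= uv] : coprimez p m.
  by rewrite coprimezE prime_coprime // -dvdzE.
have E : (u%:~R + z * v%:~R) * p%:R = 1 :> intring.
  rewrite mulrDl mulrAC [z * _]mulr_natr -mz -[p%:R]/((p%:Z)%:~R) -!intrM -intrD.
  by rewrite [m * v]mulrC uv.
have {E} := congr1 val E; rewrite rmorphM rmorph_nat rmorph1 => <-.
by apply: prime_overM (intval_ringint _) (prime_over_p _).
Qed.

Variables (D : int) (D_disc : is_discriminant F D) (pND : ~~ (p %| D)%Z).
Local Notation bar := (@pi_modpow p intring 1).

Lemma intring_basis : exists d (b : 'I_d -> intring),
  (forall a, exists c : 'I_d -> int, a = \sum_i b i *~ c i) /\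
  \det (\matrix_(i, j) trace_int (b i * b j)) = D%:~R.
Proof.
have [d [b [Ob bP bD]]] := D_disc; exists d, (fun i => to_intring (Ob i)); split.
  move=> a; have [c [E _]] := bP _ (intval_ringint a); exists c.
  apply: val_inj; rewrite E raddf_sum; apply: eq_bigr => i _.
  by rewrite raddfMz.
apply: val_inj; rewrite -det_map_mx rmorph_int -bD; congr (\det _).
by apply/matrixP => i j; rewrite !mxE; apply: val_trace_int.
Qed.

(** Each conjugate of a^p is divisible by p, and the p-th power is additive mod p. *)
Lemma trace_int_frob (a : intring) : bar a ^+ p = 0 -> bar (trace_int a) ^+ p = 0.
Proof.
rewrite -rmorphXn -(rmorph0 bar) => /pi_modpowP[z]; rewrite add0r expn1 => az.
rewrite -[LHS]/(frob p_pr _) !rmorph_sum big1 ?rmorph0 // => s _ /=.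
rewrite /frob -rmorphXn -rmorphXn az rmorphMn rmorphMn /=.
exact: modpow1_pchar.
Qed.

(* If w^p = 0 mod p then the traces tr(w b_j) are nilpotent mod p. Solving for *)
(* the coordinates c_i of w by Cramer's rule, (D c_i)^p = 0 mod p.             *)
Lemma intring_reduced (z : modpow p intring 1) : z ^+ p = 0 -> z = 0.
Proof.
have [w ->] := modpow_surj z => w0.
have [d [b [bgen bdet]]] := intring_basis; have [c wc] := bgen w.
set T := \matrix_(i, j) _ in bdet.
pose C := \row_i (c i)%:~R : 'rV[intring]_d.
have CT : C *m T = \row_j trace_int (w * b j).
  apply/rowP => j; rewrite !mxE wc mulr_suml raddf_sum.
  by apply: eq_bigr => i _; rewrite !mxE mulrzl mulrzAl raddfMz.
have DC : D%:~R *: C = (\row_j trace_int (w * b j)) *m \adj T.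
  by rewrite -CT -mulmxA mul_mx_adj bdet mul_mx_scalar.
have DC0 i : bar (D%:~R * (c i)%:~R) ^+ p = 0.
  move/rowP/(_ i): DC; rewrite !mxE => ->.
  rewrite -[LHS]/(frob p_pr _) !rmorph_sum big1 // => j _ /=.
  rewrite !mxE rmorphM rmorphM /= [frob p_pr (bar (trace_int _))]trace_int_frob ?mul0r //.
  by rewrite rmorphM exprMn w0 mul0r.
rewrite wc raddf_sum big1 // => i _ /=.
(* Divisibility of (D c_i)^p by p descends from O_F to the integers; as p does not divide D, it
   divides c_i. *)
have : (p %| D * c i)%Z.
  move: (DC0 i); rewrite -intrM -rmorphXn -(rmorph0 bar) => /pi_modpowP[y].
  rewrite add0r expn1 -rmorphXn => /dvdz_intring.
  by rewrite !dvdzE abszX Euclid_dvdX // => /andP[].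
rewrite dvdzE abszM Euclid_dvdM // -!dvdzE (negPf pND) /= => /dvdzP[m ->].
by rewrite rmorphMz /= mulrzA -pmulrn modpow1_pchar.
Qed.

(* Pigeonhole on the iterates of the injective Frobenius of the finite ring O/p. *)
Lemma frob_surjective (z : modpow p intring 1) : exists y, z = y ^+ p.
Proof.
have [d [b [bgen _]]] := intring_basis.
pose e (c : {ffun 'I_d -> 'I_p}) : modpow p intring 1 := \sum_i bar (b i) *+ c i.
have p0 := prime_gt0 p_pr.
have e_surj y : exists c, y = e c.
  have [w ->] := modpow_surj y; have [c ->] := bgen w.
  have lt i : (`|(c i %% p)%Z| < p)%N by lia.
  exists [ffun i => Ordinal (lt i)]; rewrite raddf_sum; apply: eq_bigr => i _.
  rewrite ffunE /= raddfMz {1}(divz_eq (c i) p) mulrzDr.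
  rewrite mulrzA -pmulrn modpow1_pchar add0r.
  by rewrite -{1}[(c i %% p)%Z]gez0_abs ?modz_ge0 //; lia.
(* A section of [e] embeds O_F/p into a finite set. *)
have [s sK] := choice e_surj.
pose N := #|{ffun 'I_d -> 'I_p}|.
pose f (i : 'I_N.+1) := s (z ^+ (p ^ i)).
have /injectivePn[i [j neq_ij fij]] : ~~ injectiveb f.
  by apply/negP => /injectiveP/leq_card; rewrite card_ord ltnn.
have {f fij} zij : z ^+ (p ^ i) = z ^+ (p ^ j) by rewrite [LHS]sK [RHS]sK -/(f i) fij.
have frobI k (u v : modpow p intring 1) : u ^+ (p ^ k) = v ^+ (p ^ k) -> u = v.
  elim: k u v => [//|k IH] u v; rewrite expnSr !exprM => /eqP E; apply: IH.
  apply/eqP; rewrite -subr_eq0; apply/eqP/intring_reduced.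
  by rewrite -[LHS]/(frob p_pr _) rmorphB; apply/eqP; rewrite subr_eq0.
wlog lt_ij : i j neq_ij zij / (i < j)%N.
  move=> W; case: (ltngtP i j) => [||/val_inj/eqP]; last by rewrite (negPf neq_ij).
    exact: W.
  by apply: W => //; rewrite eq_sym.
(* Cancelling the i-th iterate of Frobenius leaves z = z^(p^(j-i)), with j-i positive. *)
exists (z ^+ (p ^ (j - i).-1)); rewrite -exprM -expnSr prednK ?subn_gt0 //.
by apply: (frobI i); rewrite -exprM -expnD subnK ?zij // ltnW.
Qed.

Lemma intring_perfect (a : intring) : exists b c, a = b ^+ p + c *+ p.
Proof.
have [y] := frob_surjective (bar a); have [b ->] := modpow_surj y.
by rewrite -rmorphXn => /pi_modpowP[c ->]; exists b, c; rewrite expn1.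
Qed.

(** Write a/s = a s^(p-1) / s^p, so that the denominator is a p-th power, and decompose the
    numerator in O_F. *)
Lemma locring_perfect (x : locring P) : exists b c, x = b ^+ p + c *+ p.
Proof.
have inO (a b : F) : ringint a -> ringint b -> ~ P b -> a / b \in loc_mem P.
  by move=> Oa Ob Pb; apply/loc_memP; exists a, b.
case: x => x xP; have /loc_memP[a [s [Oa Os Ps xE]]] := xP.
have O1 : ringint (1 : F) by exact: integral1.
have P1 := @prime_over_proper _ _ P.
pose s' := to_intring Os.
have [b [c /(congr1 val)]] := intring_perfect (to_intring Oa * s' ^+ p.-1).
rewrite rmorphM !rmorphXn rmorphD rmorphXn rmorphMn /= -/(val b) -/(val c) => E.
exists (Loc (inO _ _ (intval_ringint b) Os Ps)).
exists (Loc (inO _ _ (intval_ringint c) O1 P1) * Loc (inO _ _ O1 Os Ps) ^+ p).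
apply: val_inj; rewrite rmorphD rmorphXn rmorphMn rmorphM rmorphXn /=.
rewrite divr1 div1r expr_div_n exprVn -mulrnAl -mulrDl -E xE.
have s0 := notin_prime_neq0 Ps.
have -> : s ^+ p = s * s ^+ p.-1 by rewrite -exprS prednK ?prime_gt0.
by rewrite -mulf_div divff ?expf_neq0 ?mulr1.
Qed.

End Perfect.
End RingOfIntegers.

(** * Transport of the connection to O(G^1) *)

(** The default 0 of [insubd] does no harm: a is P-integral exactly when s(a) is integral at
    s(P). *)
Lemma gal_Rhat_to (F : splittingFieldType rat) p (s : gal_of {:F}) (P : prime_over F p) a :
  gal_Rhat s P (to_Rhat P a) = to_Rhat (gal_prime s P) (s a).
Proof.
rewrite [LHS]padic_map_to; congr to_padic; apply: val_inj.
rewrite /= -!/(val _) !val_insubd.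
have -> : (s a \in loc_mem (gal_prime s P)) = (a \in loc_mem P).
  apply/idP/idP => aP; last exact: (loc_gal s (Loc aP)).
  by have := loc_galV (Loc aP); rewrite /= galKV.
by case: ifP => _ //; rewrite -!/(val _) !rmorph0.
Qed.

Section Transport.
Variables (F : splittingFieldType rat) (p n : nat).
Variables (sigma : 'I_n -> gal_of {:F}) (P : prime_over F p) (q : 'M[F]_n).
Variable delta : forall i, OG n (gal_prime (sigma i) P) -> OG n (gal_prime (sigma i) P).

(** The conjugate of delta^i on O(G^1); its attached lift is [psi delta i], the map in the
    curvature. *)
Definition pulled_delta i : OG n P -> OG n P :=
  sigmaGV sigma P i \o @delta i \o sigmaG sigma P i.

Lemma attached_pulled i : attached p (pulled_delta i) =1 psi delta i.
Proof.
by move=> a; rewrite /psi /phi /attached /= rmorphD rmorphMn rmorphXn (sigmaGK sigma i a).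
Qed.

Lemma p_derivation_pulled i : p_derivation p (@delta i) -> p_derivation p (pulled_delta i).
Proof.
move=> [pB [p1 pM]]; split; [|split] => [a b||a b]; rewrite !attached_pulled /psi /phi /=.
- by rewrite rmorphB /= pB rmorphB.
- by rewrite rmorph1 p1 rmorph1.
- by rewrite rmorphM /= pM rmorphM.
Qed.

Lemma map_sigmaGV_x i : map_mx (sigmaGV sigma P i) (OG_x n _) = OG_x n P.
Proof. exact: Ghat_map_x. Qed.

Lemma map_sigmaG_x i : map_mx (sigmaG sigma P i) (OG_x n P) = OG_x n _.
Proof. exact: Ghat_map_x. Qed.

Lemma map_pulled_x i :
  map_mx (pulled_delta i) (OG_x n P)
  = map_mx (sigmaGV sigma P i) (map_mx (@delta i) (OG_x n _)).
Proof. by rewrite -map_sigmaG_x; apply/matrixP => a b; rewrite !mxE. Qed.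

Lemma map_attached_x i :
  map_mx (attached p (pulled_delta i)) (OG_x n P)
  = map_mx (sigmaGV sigma P i) (map_mx (@phi _ _ _ _ _ delta i) (OG_x n _)).
Proof.
rewrite -map_sigmaG_x; apply/matrixP => a b.
by rewrite !mxE; apply: attached_pulled.
Qed.

Hypothesis q_inv : forall i, map_mx (sigma i) q = q.

Lemma map_sigmaG_q i : map_mx (sigmaG sigma P i) (OG_q q P) = OG_q q _.
Proof.
rewrite -[in RHS](q_inv i); apply/matrixP => a b; rewrite !mxE.
by rewrite [LHS]Ghat_map_cst gal_Rhat_to.
Qed.

Lemma map_sigmaGV_q i : map_mx (sigmaGV sigma P i) (OG_q q _) = OG_q q P.
Proof.
rewrite -map_sigmaG_q; apply/matrixP => a b.
by rewrite [LHS]mxE [map_mx (sigmaG _ _ _) _ _ _]mxE; apply: sigmaGK.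
Qed.

Lemma map_attached_q i :
  map_mx (attached p (pulled_delta i)) (OG_q q P)
  = map_mx (sigmaGV sigma P i) (map_mx (@phi _ _ _ _ _ delta i) (OG_q q _)).
Proof.
rewrite -map_sigmaG_q; apply/matrixP => a b.
rewrite [LHS]mxE [RHS]mxE [map_mx (@phi _ _ _ _ _ _ _) _ _ _]mxE.
by rewrite [map_mx (sigmaG _ _ _) _ _ _]mxE; apply: attached_pulled.
Qed.

(** Evaluating phi H = H phi_0 at x gives phi(x^t q x) = (x^t q x)^(p); then apply the inverse of
    sigma_i, which fixes x and q. *)
Lemma metric_pulled i : vertical_connection delta -> metric q delta ->
  (map_mx (attached p (pulled_delta i)) (OG_x n P))^T
    *m map_mx (attached p (pulled_delta i)) (OG_q q P)
    *m map_mx (attached p (pulled_delta i)) (OG_x n P)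
  = frob_mx p 1 ((OG_x n P)^T *m OG_q q P *m OG_x n P).
Proof.
move=> delta_conn delta_metric.
have [H [phi0 [[H_endo _ Hx] [_ _ phi0x] phiH]]] := delta_metric i.
have phi_endo : ring_endo (@phi _ _ _ _ _ delta i) by have [] := delta_conn i.
have : map_mx (@phi _ _ _ _ _ delta i) (map_mx H (OG_x n _))
    = map_mx H (map_mx phi0 (OG_x n _)).
  by apply/matrixP => a b; have := phiH (OG_x n _ a b); rewrite !mxE.
have [h hE] := ring_endo_rmorphism H_endo; rewrite phi0x hE map_frob_mx -hE Hx.
rewrite map_attached_x map_attached_q; have [f ->] := ring_endo_rmorphism phi_endo.
rewrite !map_mxM -matrix.map_trmx => /(congr1 (map_mx (sigmaGV sigma P i))).
rewrite !map_mxM -matrix.map_trmx map_frob_mx => ->.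
by rewrite !map_mxM -matrix.map_trmx map_sigmaGV_x map_sigmaGV_q.
Qed.

Lemma gamma_pulled i :
  map_mx (sigmaGV sigma P i) (gamma q delta i)
  = (map_mx (pulled_delta i) (OG_x n P))^T
    *m map_mx (attached p (pulled_delta i)) (OG_q q P)
    *m frob_mx p 1 (OG_x n P).
Proof.
rewrite /gamma !map_mxM -matrix.map_trmx map_frob_mx map_sigmaGV_x.
by rewrite map_pulled_x map_attached_q.
Qed.

End Transport.

(** The decomposition in the local ring is carried to O(G^1) by the structure morphism. *)
Lemma OG_q_perfect (F : splittingFieldType rat) p n (P : prime_over F p) (q : 'M[F]_n)
  (D : int) : prime p -> is_discriminant F D -> ~~ (p %| D)%Z ->
  forall i j, exists b c, OG_q q P i j = b ^+ p + c *+ p.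
Proof.
move=> p_pr D_disc pND i j; rewrite mxE.
have [b [c E]] := locring_perfect p_pr D_disc pND (insubd (0 : locring P) (q i j)).
pose f : {rmorphism locring P -> OG n P} :=
  (@Ghat_cst p n (Rhat P) : {rmorphism Rhat P -> OG n P}) \o
  (@to_padic p (locring P) : {rmorphism locring P -> Rhat P}).
exists (f b), (f c); rewrite -rmorphXn -rmorphMn -rmorphD -E.
reflexivity.
Qed.

Theorem corollary3p5 (F : splittingFieldType rat) (F_galois : galois 1 {:F})
  (M D : int) (M_even : (2 %| M)%Z) (D_disc : is_discriminant F D)
  (D_dvd_M : (D %| M)%Z)
  (n : nat) (sigma : 'I_n.+1 -> gal_of {:F}) (sigma1 : sigma ord0 = 1%g)
  (p : nat) (p_prime : prime p) (p_M : ~~ (p %| M)%Z)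
  (P : prime_over F p)
  (q : 'M[F]_n.+1) (q_GL : in_GL_away M q) (q_sym : q^T = q)
  (q_inv : forall i, map_mx (sigma i) q = q)
  (delta : forall i, OG n.+1 (gal_prime (sigma i) P) ->
                     OG n.+1 (gal_prime (sigma i) P))
  (delta_LC : is_levi_civita q delta)
  (varphi : 'I_n.+1 -> 'I_n.+1 -> OG n.+1 P -> OG n.+1 P)
  (varphi_curv : is_curvature delta varphi) :
  let R := riemann q varphi in
  forall i j k m : 'I_n.+1,
  [/\ eq_mod p (R i j k m) (- R i j m k),
      eq_mod p (R i j k m) (- R j i k m),
      eq_mod p (R m i j k + R m j k i + R m k i j) 0
    & eq_mod p (R i j k m) (R k m i j)].
Proof.
have [delta_conn delta_metric delta_tf] := delta_LC.
have pND : ~~ (p %| D)%Z by apply: contra p_M => /dvdz_trans; apply.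
have p_odd : odd p.
  apply: contraNT p_M => p_even; have /eqP p2 : p == 2.
    by case: (even_prime p_prime) => [->//|]; rewrite (negPf p_even).
  by rewrite p2.
apply: (riemann_symmetries p_prime p_odd (torsionfree_OG p_prime)
  (delta := pulled_delta delta)).
- by move=> i; apply: p_derivation_pulled; have [] := delta_conn i.
- by apply/matrixP => a b; rewrite !mxE -[in LHS]q_sym mxE.
- exact: OG_q_perfect p_prime D_disc pND.
- by move=> i; apply: metric_pulled.
- move=> i j k; rewrite -!gamma_pulled // [LHS]mxE [RHS]mxE.
  exact: delta_tf.
- by move=> i j f; rewrite varphi_curv !attached_pulled.
Qed.
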